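(* Let $A\in\mathbb{R}^{n\times m}$, $\eta>0$ and $T>0$. In the continuous-time zero-sum game with optimizer's utility matrix $A$ in which the learner uses the Replicator Dynamics with parameter $\eta$ and zero initial historical rewards, the optimizer's optimal utility satisfies $$\mathrm{Val}(A)\cdot T\ \le\ R^*_{cont}(\mathbf{0},T,A,-A)\ \le\ \mathrm{Val}(A)\cdot T+\frac{\ln m}{\eta}.$$
   Context: $\Delta(\mathcal{A})\subset\mathbb{R}^n$ and $\Delta(\mathcal{B})\subset\mathbb{R}^m$ are the probability simplices of the optimizer and the learner. The value of the game is $\mathrm{Val}(A)=\min_{y\in\Delta(\mathcal{B})}\max_{x\in\Delta(\mathcal{A})}x^\top Ay$. A strategy of the optimizer is a (measurable) function $x:[0,T]\to\Delta(\mathcal{A})$. Against it, the learner plays at time $t$ the mixed strategy $y(t)$ with $$y_i(t)=\frac{\exp\left(-\eta\, e_i^\top A^\top\int_0^t x(s)\,ds\right)}{\sum_{j=1}^m\exp\left(-\eta\, e_j^\top A^\top\int_0^t x(s)\,ds\right)},\qquad i=1,\dots,m,$$ where $e_1,\dots,e_m$ is the standard basis of $\mathbb{R}^m$. $R^*_{cont}(\mathbf{0},T,A,-A)$ is the maximum over strategies $x$ of the optimizer's total reward $\int_0^T x(t)^\top A\,y(t)\,dt$. *)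

(* Defs.v *)
From HB Require Import structures.
From mathcomp Require Import all_boot all_order all_algebra.
From mathcomp Require Import all_classical all_reals all_analysis.

Set Implicit Arguments.
Unset Strict Implicit.
Unset Printing Implicit Defensive.

Import Order.TTheory GRing.Theory Num.Theory numFieldNormedType.Exports.
Local Open Scope classical_set_scope.
Local Open Scope ring_scope.

Definition is_max (R : realType) (E : set R) (r : R) : Prop :=
  E r /\ ubound E r.

Definition is_min (R : realType) (E : set R) (r : R) : Prop :=
  E r /\ lbound E r.

Definition simplex (R : realType) (k : nat) : set 'cV[R]_k :=
  [set p | (forall i, 0 <= p i 0) /\ \sum_i p i 0 = 1].
Arguments simplex : clear implicits.

Definition payoff (R : realType) (n m : nat) (A : 'M[R]_(n, m))
    (x : 'cV[R]_n) (y : 'cV[R]_m) : R :=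
  (x^T *m A *m y) 0 0.

Definition best_payoff (R : realType) (n m : nat) (A : 'M[R]_(n, m))
    (y : 'cV[R]_m) : R :=
  sup [set payoff A x y | x in simplex R n].

(* For 0 < n and 0 < m the inf and the sup are a min and a max; see
   [best_payoff_is_max] and [game_value_is_min] below. *)
Definition game_value (R : realType) (n m : nat) (A : 'M[R]_(n, m)) : R :=
  inf [set best_payoff A y | y in simplex R m].

(* A strategy is a function on [0, T]; the values of [x] outside [0, T] are
   unconstrained and never used.  Borel measurability of a vector-valued map is
   measurability of its coordinates. *)
Definition strategy (R : realType) (n : nat) (T : R) (x : R -> 'cV[R]_n) :
    Prop :=
  (forall i, measurable_fun `[0, T] (fun t => x t i 0)) /\
  (forall t, t \in `[0, T] -> simplex R n (x t)).

Definition cumulative (R : realType) (n : nat) (x : R -> 'cV[R]_n) (t : R) :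
    'cV[R]_n :=
  \col_i \int[lebesgue_measure]_(s in `[0, t]) (x s i 0).

Definition replicator (R : realType) (n m : nat) (eta : R) (A : 'M[R]_(n, m))
    (x : R -> 'cV[R]_n) (t : R) : 'cV[R]_m :=
  \col_i (expR (- eta * (A^T *m cumulative x t) i 0) /
          \sum_j expR (- eta * (A^T *m cumulative x t) j 0)).

Definition total_reward (R : realType) (n m : nat) (eta T : R)
    (A : 'M[R]_(n, m)) (x : R -> 'cV[R]_n) : R :=
  \int[lebesgue_measure]_(t in `[0, T])
    payoff A (x t) (replicator eta A x t).

Definition rewards (R : realType) (n m : nat) (eta T : R) (A : 'M[R]_(n, m)) :
    set R :=
  [set total_reward eta T A x | x in strategy T].

Definition optimal_reward (R : realType) (n m : nat) (eta T : R)
    (A : 'M[R]_(n, m)) : R :=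
  sup (rewards eta T A).

Section ValueAttained.
Context (R : realType) (n m : nat) (A : 'M[R]_(n.+1, m.+1)).

Let maxrow (y : 'cV[R]_m.+1) : R :=
  \big[Num.max/(A *m y) ord0 0]_(i < n.+1) (A *m y) i 0.

Lemma simplex_delta (k : nat) (i : 'I_k) : simplex R k (delta_mx i 0).
Proof.
split=> [j|]; first by rewrite mxE; case: (_ && _).
rewrite (bigD1 i) //= big1 ?addr0 => [|j ji]; rewrite mxE ?eqxx //.
by rewrite (negbTE ji).
Qed.

Lemma payoffE (x : 'cV[R]_n.+1) (y : 'cV[R]_m.+1) :
  payoff A x y = \sum_i x i 0 * (A *m y) i 0.
Proof. by rewrite /payoff -mulmxA mxE; apply: eq_bigr => i _; rewrite mxE. Qed.

Lemma maxrow_is_max (y : 'cV[R]_m.+1) :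
  is_max [set payoff A x y | x in simplex R n.+1] (maxrow y).
Proof.
split.
- have [i Hi] : exists i, maxrow y = (A *m y) i 0.
    rewrite /maxrow; elim/big_ind: _ => [|u v [i ->] [j ->]|i _];
      [by exists ord0| |by exists i].
    by rewrite /Num.max; case: ifP => _; [exists j|exists i].
  exists (delta_mx i 0); first exact: simplex_delta.
  rewrite Hi payoffE (bigD1 i) //= big1 ?addr0 => [|j ji].
    by rewrite mxE !eqxx mul1r.
  by rewrite mxE (negbTE ji) mul0r.
- move=> _ [x [x0 x1] <-]; rewrite payoffE -[leRHS]mul1r -x1 mulr_suml.
  by apply: ler_sum => i _; apply: ler_wpM2l => //; rewrite /maxrow; apply: (le_bigmax _ (fun i => (A *m y) i 0)).
Qed.

Lemma is_max_sup (E : set R) (r : R) : is_max E r -> sup E = r.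
Proof.
move=> [Er Ur]; apply/eqP; rewrite eq_le; apply/andP; split.
  by apply: ge_sup => //; exists r.
by apply: ub_le_sup => //; exists r.
Qed.

Lemma is_min_inf (E : set R) (r : R) : is_min E r -> inf E = r.
Proof.
move=> [Er Lr]; apply/eqP; rewrite eq_le; apply/andP; split.
  by apply: ge_inf => //; exists r.
by apply: lb_le_inf => //; exists r.
Qed.

Lemma best_payoff_is_max (y : 'cV[R]_m.+1) :
  is_max [set payoff A x y | x in simplex R n.+1] (best_payoff A y).
Proof. by rewrite /best_payoff (is_max_sup (maxrow_is_max y)); exact: maxrow_is_max. Qed.

Lemma game_value_is_min :
  is_min [set best_payoff A y | y in simplex R m.+1] (game_value A).
Proof.
suff [r Hr] : exists r, is_min [set best_payoff A y | y in simplex R m.+1] r.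
  by rewrite /game_value (is_min_inf Hr).
pose S : set 'rV[R]_m.+1 := [set v | simplex R m.+1 v^T].
have cc i : continuous (fun v : 'rV[R]_m.+1 => v 0 i) by exact: coord_continuous.
have Sc : compact S.
  apply: bounded_closed_compact.
    exists 1; split => // M M1 v [v0 v1].
    apply: (@le_trans _ _ 1); last exact: ltW.
    rewrite /Num.norm /= mx_normrE; apply/bigmax_leP; split=> // -[i j] _ /=.
    rewrite (ord1 i); have -> : v 0 j = v^T j 0 by rewrite mxE.
    rewrite ger0_norm // -v1 (bigD1 j) //= lerDl; exact: sumr_ge0.
  have -> : S = (\bigcap_i [set v | 0 <= v 0 i]) `&`
                [set v | \sum_i v 0 i = 1].
    apply/seteqP; split=> v /= [v0 v1]; split.
    - by move=> i _ /=; have := v0 i; rewrite mxE.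
    - by rewrite -v1; apply: eq_bigr => i _; rewrite mxE.
    - by move=> i; rewrite mxE; exact: v0 i I.
    - by rewrite -v1; apply: eq_bigr => i _; rewrite mxE.
  apply: closedI.
    apply: closed_bigI => i _.
    apply: (preimage_closed (f := fun v : 'rV[R]_m.+1 => v 0 i)
                            (D := [set r | 0 <= r])); last exact: closed_ge.
    by move=> v _; exact: cc.
  apply: (preimage_closed (f := fun v : 'rV[R]_m.+1 => \sum_i v 0 i)
                          (D := [set 1])); last exact: closed_eq.
  have cs : continuous (fun v : 'rV[R]_m.+1 => \sum_i v 0 i).
    by apply: (continuous_big (U := R)) => [|i _];
      [exact: (@add_continuous R)|exact: cc].
  by move=> v _; exact: cs.
have cA i : continuous (fun v : 'rV[R]_m.+1 => (A *m v^T) i 0).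
  have -> : (fun v : 'rV[R]_m.+1 => (A *m v^T) i 0) =
            (fun v => \sum_j A i j * v 0 j).
    by apply/funext => v; rewrite mxE; apply: eq_bigr => j _; rewrite mxE.
  apply: (continuous_big (U := R)) => [|j _]; first exact: (@add_continuous R).
  by move=> v; exact: cvgM (cvg_cst _) (cc j v).
have cf : continuous (fun v : 'rV[R]_m.+1 => maxrow v^T).
  rewrite /maxrow; elim: (index_enum _) => [|i s IH].
    by under eq_fun do rewrite big_nil; exact: cA.
  under eq_fun do rewrite big_cons.
  by move=> v; apply: continuous_max; [exact: cA|exact: IH].
have S0 : S !=set0.
  by exists (delta_mx 0 ord0); rewrite /S /= trmx_delta; exact: simplex_delta.
have [c cS cmin] := EVT_min_rV S0 Sc (continuous_subspaceT cf).
have bpE y : best_payoff A y = maxrow y by exact: is_max_sup (maxrow_is_max y).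
exists (maxrow c^T); split.
  by exists c^T; [exact: set_mem cS|rewrite bpE].
move=> _ [y Sy <-]; rewrite bpE -[y]trmxK; apply: cmin.
by apply/mem_set; rewrite /S /= trmxK.
Qed.

End ValueAttained.

(* Main.v *)
Require Import Defs.
From mathcomp Require Import all_boot all_order all_algebra.
From mathcomp Require Import all_classical all_reals all_analysis.
From mathcomp Require Import measurable_realfun.
From mathcomp Require Import ring lra.

Set Implicit Arguments.
Unset Strict Implicit.
Unset Printing Implicit Defensive.

Import Order.TTheory GRing.Theory Num.Theory numFieldNormedType.Exports.
Local Open Scope classical_set_scope.
Local Open Scope ring_scope.

(* Write [lse u = ln (\sum_j exp u_j)], whose gradient is the softmax.  Since the
   learner plays the softmax of [u t = - eta * A^T * \int_0^t x], the reward rate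
   is [- eta^-1] times the derivative of [lse (u t)], so the total reward is
   [(ln m - lse (u T)) / eta] and depends only on the time average [p] of [x].
   The maximum over [p] in the simplex exists by compactness.  The upper bound
   is [lse u >= \sum_j y_j u_j] for an optimal learner strategy [y].  For the
   lower bound, first-order optimality says that an optimal [p] is a best
   response to the final learner strategy [y], so [x^T A y <= p^T A y] for all [x]
   and [Val <= p^T A y]; convexity of [lse] between [u T] and [0] then bounds the
   reward from below by [T * p^T A y].

   As [x] is only measurable, the chain rule for [lse (u t)] is obtained without
   derivatives: the convexity inequality at both ends of [s, t] shows that
   [lse (u t)] and the claimed integral have increments differing by
   [O ((t - s) ^ 2)]. *)

(** * Log-sum-exp and softmax: convexity, Lipschitz bounds, first-order optimality *)

Definition logsumexp (R : realType) (m : nat) (u : 'I_m -> R) : R :=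
  ln (\sum_j expR (u j)).

Definition softmax (R : realType) (m : nat) (u : 'I_m -> R) (j : 'I_m) : R :=
  expR (u j) / \sum_k expR (u k).

Section LogSumExp.
Context (R : realType) (m : nat).
Implicit Types u v : 'I_m.+1 -> R.

Lemma sum_expR_gt0 u : 0 < \sum_j expR (u j).
Proof.
by rewrite big_ord_recl ltr_pwDl ?expR_gt0 // sumr_ge0 // => j _; exact: expR_ge0.
Qed.

Lemma softmaxE u j : softmax u j = expR (u j - logsumexp u).
Proof. by rewrite expRB lnK // posrE sum_expR_gt0. Qed.

Lemma softmax_ge0 u j : 0 <= softmax u j.
Proof. by rewrite softmaxE expR_ge0. Qed.

Lemma softmax_sum1 u : \sum_j softmax u j = 1.
Proof. by rewrite -mulr_suml divff // gt_eqF // sum_expR_gt0. Qed.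

Lemma softmax_le1 u j : softmax u j <= 1.
Proof.
rewrite -(softmax_sum1 u) (bigD1 j) //= lerDl.
by apply: sumr_ge0 => i _; exact: softmax_ge0.
Qed.

Lemma le_logsumexp u j : u j <= logsumexp u.
Proof. by rewrite -subr_le0 -expR_le1 -softmaxE softmax_le1. Qed.

Lemma logsumexp0 : logsumexp (fun _ : 'I_m.+1 => 0 : R) = ln m.+1%:R.
Proof.
rewrite /logsumexp; congr ln; under eq_bigr do rewrite expR0.
by rewrite sumr_const card_ord.
Qed.

(** Convexity without derivatives: [softmax v j] is [softmax u j] times the exponential of some [z],
    bounded below through [expR z >= 1 + z]; in the sum over [j] the two total masses cancel. *)
Lemma logsumexp_tangent u v :
  \sum_j softmax u j * (v j - u j) <= logsumexp v - logsumexp u.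
Proof.
have key j : softmax u j * (v j - u j) <=
    softmax v j - softmax u j + softmax u j * (logsumexp v - logsumexp u).
  have -> : softmax v j =
      softmax u j * expR ((v j - u j) - (logsumexp v - logsumexp u)).
    by rewrite !softmaxE -expRD; congr expR; ring.
  have := ler_wpM2l (softmax_ge0 u j)
    (expR_ge1Dx ((v j - u j) - (logsumexp v - logsumexp u))).
  by lra.
apply: (le_trans (ler_sum _ (fun j _ => key j))).
rewrite big_split /= sumrB !softmax_sum1 subrr add0r.
by rewrite -mulr_suml softmax_sum1 mul1r.
Qed.

(** The gradient is a probability vector, so the tangent inequality gives constant 1 for the maximum
    norm. *)
Lemma logsumexp_lipschitz u v (d : R) : (forall j, `|v j - u j| <= d) ->
  `|logsumexp v - logsumexp u| <= d.
Proof.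
suff H u' v' : (forall j, `|v' j - u' j| <= d) ->
    logsumexp v' - logsumexp u' <= d.
  move=> duv; rewrite ler_norml H // andbT lerNl opprB H // => j.
  by rewrite distrC.
move=> duv; rewrite -lerN2 opprB; apply: le_trans (logsumexp_tangent v' u').
rewrite -[- d]mul1r -(softmax_sum1 v') mulr_suml; apply: ler_sum => j _.
apply: ler_wpM2l; first exact: softmax_ge0.
by have := duv j; rewrite distrC ler_norml => /andP[].
Qed.

(* [expR] is 1-Lipschitz on the nonpositive reals, where the logarithm
   [u j - logsumexp u] of [softmax u j] lives. *)
Lemma softmax_lipschitz u v (d : R) (j : 'I_m.+1) :
  (forall j, `|v j - u j| <= d) -> `|softmax v j - softmax u j| <= 2 * d.
Proof.
suff H u' v' : (forall j, `|v' j - u' j| <= d) ->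
    softmax v' j - softmax u' j <= 2 * d.
  move=> duv; rewrite ler_norml H // andbT lerNl opprB H // => k.
  by rewrite distrC.
move=> duv.
have d0 : 0 <= d := le_trans (normr_ge0 _) (duv j).
have := duv j; rewrite ler_norml => /andP[_ d1].
have := logsumexp_lipschitz duv; rewrite ler_norml => /andP[d2 _].
pose e := (v' j - u' j) - (logsumexp v' - logsumexp u').
have -> : softmax u' j = softmax v' j * expR (- e).
  by rewrite !softmaxE -expRD; congr expR; rewrite /e; ring.
have ed : e <= 2 * d by rewrite /e; lra.
have := ler_wpM2l (softmax_ge0 v' j) (expR_ge1Dx (- e)).
have := ler_wpM2l (softmax_ge0 v' j) ed.
have := ler_wpM2r (mulr_ge0 (ler0n R 2) d0) (softmax_le1 v' j).
by lra.
Qed.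

(** The tangent inequality at the shifted point [v], evaluated at [u], gives the claim with weights
    [softmax v]. Passing back to [softmax u] costs a multiple of [e], and [e] can be taken small. *)
Lemma logsumexp_first_order u (d : 'I_m.+1 -> R) :
  (forall e, 0 < e <= 1 -> logsumexp u <= logsumexp (fun j => u j + e * d j)) ->
  0 <= \sum_j softmax u j * d j.
Proof.
move=> umin; pose W := \sum_j `|d j|.
have W0 : 0 <= W by exact: sumr_ge0.
(* [W] bounds every [|d k|], so the shift moves each weight by at most [2 * (e * W)]; summing
   against [|d j|] brings in the second factor [W]. *)
have approx e : 0 < e <= 1 -> 0 <= \sum_j softmax u j * d j + 2 * W ^+ 2 * e.
  move=> e01; pose v j := u j + e * d j.
  have /andP[e0 _] := e01.
  have vd : 0 <= \sum_j softmax v j * d j.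
    have := logsumexp_tangent v u.
    have -> : \sum_j softmax v j * (u j - v j) = - (e * \sum_j softmax v j * d j).
      by rewrite mulr_sumr -sumrN; apply: eq_bigr => j _; rewrite /v; ring.
    by rewrite -(pmulr_rge0 _ e0); have := umin e e01; rewrite -/v; lra.
  apply: le_trans vd _; rewrite -lerBlDl -sumrB expr2.
  rewrite (_ : 2 * (W * W) * e = \sum_j 2 * (e * W) * `|d j|); last first.
    by rewrite -mulr_sumr -/W; ring.
  apply: ler_sum => j _; rewrite -mulrBl; apply: le_trans (ler_norm _) _.
  rewrite normrM; apply: ler_wpM2r => //; apply: softmax_lipschitz => k.
  rewrite /v addrC addKr normrM gtr0_norm //; apply: ler_wpM2l; first exact: ltW.
  by rewrite /W (bigD1 k) //= lerDl sumr_ge0.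
set S := \sum_j _ in approx *; rewrite leNgt; apply/negP => S0.
have den : 0 < 2 * W ^+ 2 - S by have := sqr_ge0 W; lra.
(* With [S < 0], this step size turns the bound into [- S ^+ 2 / (2 * W ^+ 2 - S) < 0]. The summand
   [- S] in the denominator keeps it positive when [W = 0] and keeps the step at most 1. *)
have e01 : 0 < - S / (2 * W ^+ 2 - S) <= 1.
  rewrite ltr_pdivlMr // ler_pdivrMr // mul0r mul1r oppr_gt0 S0 /=.
  by have := sqr_ge0 W; lra.
have := approx _ e01.
have -> : S + 2 * W ^+ 2 * (- S / (2 * W ^+ 2 - S)) =
    - (S ^+ 2 / (2 * W ^+ 2 - S)) by field; rewrite gt_eqF.
by rewrite oppr_ge0 leNgt divr_gt0 // exprn_even_gt0 //= lt_eqF.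
Qed.

End LogSumExp.

(** Cutting [[0, T]] into [N + 1] equal pieces bounds the total increment by [C * T ^+ 2 / (N + 1)],
    which is arbitrarily small. *)
Lemma eq_of_quadratic_increments (R : realType) (D : R -> R) (C T : R) :
  0 <= T ->
  (forall s t, 0 <= s -> s <= t -> t <= T -> `|D t - D s| <= C * (t - s) ^+ 2) ->
  D T = D 0.
Proof.
move=> T0 HD; apply/eqP; rewrite -subr_eq0 -normr_le0 leNgt; apply/negP => D0.
have bnd N : `|D T - D 0| * N.+1%:R <= C * T ^+ 2.
  pose s k : R := T / N.+1%:R * k%:R.
  have sE k : s k.+1 - s k = T / N.+1%:R by rewrite /s -mulrBr -natr1; ring.
  have -> : D T - D 0 = \sum_(0 <= k < N.+1) (D (s k.+1) - D (s k)).
    by rewrite (telescope_sumr (fun k => D (s k))) // /s mulr0 divfK.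
  have -> : C * T ^+ 2 = (\sum_(0 <= k < N.+1) C * (T / N.+1%:R) ^+ 2) * N.+1%:R.
    rewrite sumr_const_nat subn0 -mulr_natr; field.
    by rewrite addrC natr1 pnatr_eq0.
  rewrite ler_wpM2r ?ler0n //; apply: le_trans (ler_norm_sum _ _ _) _.
  rewrite !big_mkord; apply: ler_sum => -[k kN] _ /=; rewrite -(sE k); apply: HD.
  - by rewrite /s !mulr_ge0 ?invr_ge0.
  - by rewrite -subr_ge0 sE divr_ge0.
  - rewrite /s -mulrA ler_piMr // mulrC ler_pdivrMr ?ltr0n // mul1r.
    by rewrite ler_nat.
pose N := Num.bound (C * T ^+ 2 / `|D T - D 0|).
(* The case of a single piece supplies the sign that [archi_boundP] requires. *)
have CT0 : 0 <= C * T ^+ 2 := le_trans (mulr_ge0 (normr_ge0 _) (ler0n _ 1)) (bnd 0).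
have /archi_boundP : 0 <= C * T ^+ 2 / `|D T - D 0| by rewrite divr_ge0.
rewrite -/N ltr_pdivrMr // ltNge => /negP; apply.
apply: le_trans (bnd N); rewrite mulrC ler_wpM2l //.
by rewrite ler_nat.
Qed.

(** * Integrals of finite linear combinations *)

Lemma integrable_lincomb (d : measure_display) (X : measurableType d)
    (R : realType) (mu : {measure set X -> \bar R}) (D : set X) (I : Type)
    (s : seq I) (p : I -> R) (c : I -> X -> R) :
  measurable D -> (forall i, mu.-integrable D (EFin \o c i)) ->
  mu.-integrable D (EFin \o (fun x => \sum_(i <- s) p i * c i x)).
Proof.
move=> mD ic.
have -> : EFin \o (fun x => \sum_(i <- s) p i * c i x) =
    (fun x => \sum_(i <- s) (p i * c i x)%:E)%E.
  by apply/funext => x /=; rewrite sumEFin.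
apply: integrable_sum => // i _.
by rewrite (_ : (fun _ => _) = (fun x => (p i)%:E * (EFin \o c i) x)%E) //;
  exact: integrableZl.
Qed.

Lemma Rintegral_lincomb (d : measure_display) (X : measurableType d)
    (R : realType) (mu : {measure set X -> \bar R}) (D : set X) (I : Type)
    (s : seq I) (p : I -> R) (c : I -> X -> R) :
  measurable D -> (forall i, mu.-integrable D (EFin \o c i)) ->
  \int[mu]_(x in D) (\sum_(i <- s) p i * c i x) =
  \sum_(i <- s) p i * \int[mu]_(x in D) c i x.
Proof.
move=> mD ic; elim: s => [|i s IH].
  under eq_Rintegral do rewrite big_nil.
  by rewrite big_nil Rintegral_cst // mul0r.
under eq_Rintegral do rewrite big_cons.
rewrite big_cons RintegralD // ?RintegralZl ?IH //; last exact: integrable_lincomb.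
(* The head term is a linear combination over a one-element list. *)
by have := integrable_lincomb [:: i] p mD ic;
  apply: eq_integrable => // x _ /=; rewrite big_seq1.
Qed.

(** * Chain rule for log-sum-exp along integrals of bounded measurable functions *)

Section ChainRule.
Context (R : realType) (m : nat) (T K : R) (c : 'I_m.+1 -> R -> R).
Context (T0 : 0 <= T).
Context (mc : forall j, measurable_fun `[0, T] (c j)).
Context (bc : forall j t, t \in `[0, T] -> `|c j t| <= K).
Notation mu := (@lebesgue_measure R).

Let u (t : R) (j : 'I_m.+1) : R := \int[mu]_(s in `[0, t]) c j s.
Let g (t : R) : R := \sum_j softmax (u t) j * c j t.

Let bounded_integrable (f : R -> R) (M : R) : measurable_fun `[0, T] f ->
  (forall t, t \in `[0, T] -> `|f t| <= M) ->
  mu.-integrable `[0, T] (EFin \o f).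
Proof.
move=> mf bf; apply: measurable_bounded_integrable => //.
  exact/compact_finite_measure/segment_compact.
exists M; split; first exact: num_real.
by move=> M' MM' t tT; apply: le_trans (ltW MM'); exact: bf.
Qed.

Let ic j : mu.-integrable `[0, T] (EFin \o c j).
Proof. exact: bounded_integrable (mc j) (bc j). Qed.

Let measurable_softmax j : measurable_fun `[0, T] (fun t => softmax (u t) j).
Proof.
(* An integral is continuous in its upper endpoint, hence measurable in it. *)
have mu_ k : measurable_fun `[0, T] (u ^~ k).
  apply: subspace_continuous_measurable_fun => //.
  exact: parameterized_integral_continuous.
rewrite (_ : (fun t => _) = (fun t => expR (u t j - logsumexp (u t)))).
  apply: measurableT_comp => //; apply: measurable_funB => //.
  apply: measurableT_comp => //; apply: measurable_sum => k.
  exact: measurableT_comp.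
by apply/funext => t; rewrite softmaxE.
Qed.

Lemma integrable_softmax :
  mu.-integrable `[0, T] (EFin \o (fun t => \sum_j softmax (u t) j * c j t)).
Proof.
apply: (@bounded_integrable g (\sum_(j < m.+1) K)).
  by apply: measurable_sum => j; apply: measurable_funM.
move=> t tT; apply: le_trans (ler_norm_sum _ _ _) _; apply: ler_sum => j _.
rewrite normrM ger0_norm ?softmax_ge0 //.
apply: le_trans (bc j tT); apply: ler_piMl => //; exact: softmax_le1.
Qed.

Let integral_increment (f : R -> R) s t :
    mu.-integrable `[0, T] (EFin \o f) -> 0 <= s -> s <= t -> t <= T ->
  \int[mu]_(r in `[0, t]) f r - \int[mu]_(r in `[0, s]) f r =
  \int[mu]_(r in `]s, t]) f r.
Proof.
move=> fi s0 st tT; apply: Rintegral_itvB; rewrite ?bnd_simp //.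
by apply: integrableS fi => //; apply: subset_itvl; rewrite bnd_simp.
Qed.

Let integrable_sub (f : R -> R) s t :
    mu.-integrable `[0, T] (EFin \o f) -> 0 <= s -> t <= T ->
  mu.-integrable `]s, t] (EFin \o f).
Proof.
move=> fi s0 tT; apply: integrableS fi => // r /=.
by rewrite !in_itv /= => /andP[sr rt]; apply/andP; split; lra.
Qed.

Let integral_bound (f : R -> R) (M s t : R) :
    mu.-integrable `]s, t] (EFin \o f) -> 0 <= s -> s <= t -> t <= T ->
  (forall r, r \in `]s, t] -> `|f r| <= M) ->
  `|\int[mu]_(r in `]s, t]) f r| <= M * (t - s).
Proof.
move=> fi s0 st tT fM; apply: le_trans (le_normr_Rintegral _ _) _ => //.
have mst : fine (mu `]s, t]) = t - s.
  rewrite lebesgue_measure_itv /= lte_fin; case: ltP => //= ts.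
  by have -> : s = t by [apply/eqP; rewrite eq_le st]; rewrite subrr.
rewrite -mst -Rintegral_cst //; apply: le_Rintegral => //.
- exact: integrable_norm.
- apply: (@integrable_sub (cst M)) => //.
  by apply: (bounded_integrable (M := `|M|)) => //; exact: measurable_cst.
Qed.

Let K0 : 0 <= K.
Proof.
apply: le_trans (normr_ge0 _) (bc ord0 (t := 0) _).
by rewrite in_itv /= lexx.
Qed.

Let u_lipschitz s t j : 0 <= s -> s <= t -> t <= T ->
  `|u t j - u s j| <= K * (t - s).
Proof.
move=> s0 st tT; rewrite /u integral_increment //.
apply: integral_bound => //; first exact: integrable_sub.
move=> r; rewrite in_itv /= => /andP[sr rt]; apply: bc; rewrite in_itv /=.
by apply/andP; split; lra.
Qed.

(** Freezing the weights at time [q] turns the integral of [g] over []s, t]] into the tangent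
    expression. On that interval the weights vary by at most [2 * (K * (t - s))], they multiply
    values of size at most [K], and integrating gives the second factor [t - s]. *)
Let tangent_increment s t q : 0 <= s -> s <= q -> q <= t -> t <= T ->
  `|\sum_j softmax (u q) j * (u t j - u s j) -
    (\int[mu]_(r in `[0, t]) g r - \int[mu]_(r in `[0, s]) g r)| <=
  (\sum_(j < m.+1) 2 * K * K) * (t - s) ^+ 2.
Proof.
move=> s0 sq qt tT; have st := le_trans sq qt.
have ici j : mu.-integrable `]s, t] (EFin \o c j) by exact: integrable_sub.
have ig : mu.-integrable `[0, T] (EFin \o g) by exact: integrable_softmax.
have igi : mu.-integrable `]s, t] (EFin \o g) by exact: integrable_sub.
pose f r := \sum_j softmax (u q) j * c j r.
have ifi : mu.-integrable `]s, t] (EFin \o f) by exact: integrable_lincomb.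
rewrite (integral_increment ig) // /u.
under eq_bigr do rewrite (integral_increment (ic _)) //.
rewrite -Rintegral_lincomb // -(RintegralB _ ifi igi) // expr2 mulrA.
apply: integral_bound => //; first exact: (integrableB _ ifi igi).
move=> r; rewrite in_itv /= => /andP[sr rt].
rewrite -sumrB; apply: le_trans (ler_norm_sum _ _ _) _.
rewrite mulr_suml; apply: ler_sum => j _; rewrite -mulrBl normrM.
have -> : 2 * K * K * (t - s) = 2 * (K * (t - s)) * K by ring.
apply: ler_pM => //; last by apply: bc; rewrite in_itv /=; apply/andP; split; lra.
apply: softmax_lipschitz => k.
have [qr|rq] := leP q r.
  rewrite distrC; apply: le_trans (u_lipschitz _ _ _ _) _; try lra.
  by apply: ler_wpM2l => //; lra.
apply: le_trans (u_lipschitz _ _ _ _) _; try lra.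
by apply: ler_wpM2l => //; lra.
Qed.

Lemma integral_softmax :
  \int[mu]_(t in `[0, T]) (\sum_j softmax (u t) j * c j t) =
  logsumexp (u T) - ln m.+1%:R.
Proof.
pose D t := logsumexp (u t) - \int[mu]_(r in `[0, t]) g r.
have : D T = D 0.
  apply: (@eq_of_quadratic_increments _ _ (\sum_(j < m.+1) 2 * K * K)) => //.
  move=> s t s0 st tT; rewrite /D opprD addrACA -opprD.
  (* The increment of log-sum-exp lies between its tangent expressions at [s] and at [t]; both are
     within the quadratic error of the integral, so the increment is too. *)
  have squeeze (a p q i e : R) : p <= a -> a <= q ->
      `|p - i| <= e -> `|q - i| <= e -> `|a - i| <= e.
    by rewrite !ler_norml; lra.
  apply: (squeeze _ _ _ _ _ (logsumexp_tangent (u s) (u t)) _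
    (tangent_increment s0 (lexx s) st tT) (tangent_increment s0 st (lexx t) tT)).
  rewrite -lerN2 opprB -sumrN; apply: le_trans (logsumexp_tangent (u t) (u s)).
  by apply: ler_sum => j _; rewrite -mulrN opprB.
have u0 : u 0 = fun=> 0.
  by apply/funext => j; rewrite /u set_itv1 Rintegral_set1.
rewrite /D u0 logsumexp0 set_itv1 Rintegral_set1 subr0 => <-.
by rewrite opprB addrC subrK.
Qed.

End ChainRule.

(** * Compactness of the simplex *)

Lemma simplex_le1 (R : realType) (k : nat) (p : 'cV[R]_k) (i : 'I_k) :
  simplex R k p -> p i 0 <= 1.
Proof. by move=> [p0 <-]; rewrite (bigD1 i) //= lerDl sumr_ge0. Qed.

(** Row vectors are the form to which [EVT_min_rV] applies. *)
Lemma compact_simplex (R : realType) (k : nat) :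
  compact [set v : 'rV[R]_k.+1 | simplex R k.+1 v^T].
Proof.
set S := mkset _.
have cc i : continuous (fun v : 'rV[R]_k.+1 => v 0 i) by exact: coord_continuous.
apply: bounded_closed_compact.
  exists 1; split=> // M M1 v Sv; apply: le_trans (ltW M1).
  rewrite /Num.norm /= mx_normrE; apply/bigmax_leP; split=> // -[i j] _ /=.
  rewrite (ord1 i) -[v]trmxK mxE ger0_norm ?simplex_le1 //.
  by case: Sv => + _; apply.
rewrite (_ : S =
    (\bigcap_i [set v | 0 <= v 0 i]) `&` [set v | \sum_i v 0 i = 1]).
  apply: closedI.
    apply: closed_bigI => i _.
    apply: (preimage_closed (f := fun v : 'rV[R]_k.+1 => v 0 i)
      (D := [set r | 0 <= r])); last exact: closed_ge.
    by move=> v _; exact: cc.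
  apply: (preimage_closed (f := fun v : 'rV[R]_k.+1 => \sum_i v 0 i)
    (D := [set 1])); last exact: closed_eq.
  by move=> v _; apply: (continuous_big (U := R)); first exact: (@add_continuous R).
apply/seteqP; split=> v [v0 v1]; split.
- by move=> i _ /=; have := v0 i; rewrite mxE.
- by rewrite /= -v1; apply: eq_bigr => i _; rewrite mxE.
- by move=> i; rewrite mxE; exact: v0.
- by rewrite -[RHS]v1; apply: eq_bigr => i _; rewrite mxE.
Qed.

(** * The total reward as a function of the time average of the strategy *)

Section Reward.
Context (R : realType) (n m : nat) (A : 'M[R]_(n.+1, m.+1)) (eta T : R).
Context (eta0 : 0 < eta) (T0 : 0 < T).
Notation mu := (@lebesgue_measure R).
Implicit Types x : R -> 'cV[R]_n.+1.

(** The exponents of the learner's weights when the optimizer's accumulated play is [p]. *)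
Definition score (p : 'cV[R]_n.+1) (j : 'I_m.+1) : R :=
  - eta * (A^T *m p) j 0.

Lemma scoreZ a p j : score (a *: p) j = a * score p j.
Proof. by rewrite /score -scalemxAr mxE; ring. Qed.

Lemma scoreE p j : score p j = \sum_i (- eta * A i j) * p i 0.
Proof.
by rewrite /score mxE mulr_sumr; apply: eq_bigr => i _; rewrite mxE mulrA.
Qed.

Lemma payoff_score p y : payoff A p y = - eta^-1 * \sum_j y j 0 * score p j.
Proof.
rewrite /payoff mxE mulr_sumr; apply: eq_bigr => j _.
rewrite /score -[A^T *m p]trmxK trmx_mul trmxK [in RHS]mxE.
by field; rewrite gt_eqF.
Qed.

Lemma replicatorE x t j :
  replicator eta A x t j 0 = softmax (score (Defs.cumulative x t)) j.
Proof. by rewrite mxE. Qed.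

Lemma integrable_strategy x t i : strategy T x -> t <= T ->
  mu.-integrable `[0, t] (EFin \o (fun s => x s i 0)).
Proof.
move=> [mx sx] tT.
have ix : mu.-integrable `[0, T] (EFin \o (fun s => x s i 0)).
  apply: measurable_bounded_integrable; [by []| |exact: mx|].
    exact/compact_finite_measure/segment_compact.
  exists 1; split => // M M1 s sT; apply: le_trans (ltW M1).
  by rewrite ger0_norm ?simplex_le1; [|exact: sx|case: (sx s sT) => + _; apply].
by apply: integrableS ix => //; apply: subset_itvl; rewrite bnd_simp.
Qed.

Lemma score_cumulative x t j : strategy T x -> t <= T ->
  score (Defs.cumulative x t) j = \int[mu]_(s in `[0, t]) score (x s) j.
Proof.
move=> sx tT; under eq_Rintegral do rewrite scoreE.
rewrite scoreE Rintegral_lincomb // => [|i]; last exact: integrable_strategy.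
by apply: eq_bigr => i _; rewrite mxE.
Qed.

Lemma total_rewardE x : strategy T x ->
  total_reward eta T A x =
  (ln m.+1%:R - logsumexp (score (Defs.cumulative x T))) / eta.
Proof.
move=> sx; pose c j t := score (x t) j.
have mc j : measurable_fun `[0, T] (c j).
  rewrite (_ : c j = (fun t => \sum_i (- eta * A i j) * x t i 0)).
    apply: measurable_sum => i; apply: measurable_funM => //.
    by case: sx => + _; apply.
  by apply/funext => t; rewrite /c scoreE.
(* Summing over all columns makes the bound independent of [j], as [integral_softmax] requires. *)
have bc j t : t \in `[0, T] -> `|c j t| <= \sum_j \sum_i `|eta * A i j|.
  move=> tT; rewrite /c scoreE; apply: le_trans (ler_norm_sum _ _ _) _.
  rewrite [leRHS](bigD1 j) //= -[leLHS]addr0; apply: lerD; last first.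
    by apply: sumr_ge0 => k _; exact: sumr_ge0.
  apply: ler_sum => i _; rewrite mulNr mulNr normrN normrM.
  have sxt := sx.2 t tT.
  by rewrite ler_piMr // ger0_norm ?simplex_le1 //; case: sxt => + _; apply.
have uE t : t \in `[0, T] ->
    (fun j => \int[mu]_(s in `[0, t]) c j s) = score (Defs.cumulative x t).
  rewrite in_itv /= => /andP[_ tT].
  by apply/funext => j; rewrite (score_cumulative _ sx tT).
have TT : T \in `[0, T] by rewrite in_itv /= lexx ltW.
rewrite -(uE T TT) -opprB mulNr mulrC -mulNr.
rewrite -(integral_softmax (ltW T0) mc bc).
rewrite -RintegralZl //; last exact: integrable_softmax (ltW T0) mc bc.
apply: eq_Rintegral => t /set_mem tT; rewrite payoff_score; congr (_ * _).
by apply: eq_bigr => j _; rewrite replicatorE (uE t tT).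
Qed.

(** The reward of any strategy whose time average is [p], since its accumulated play at time [T] is
    [T *: p]. *)
Definition mean_reward (p : 'cV[R]_n.+1) : R :=
  (ln m.+1%:R - logsumexp (score (T *: p))) / eta.

(** The time average of a strategy lies in the simplex, and every [p] in the simplex is the average
    of the constant strategy [p]. *)
Lemma rewardsE :
  rewards eta T A = [set mean_reward p | p in simplex R n.+1].
Proof.
have mT : fine (mu `[0, T]) = T.
  by rewrite lebesgue_measure_itv /= lte_fin T0 /= subr0.
apply/seteqP; split=> [_ [x sx <-]|_ [p sp <-]].
- exists (T^-1 *: Defs.cumulative x T); last first.
    by rewrite /mean_reward scalerA divff ?gt_eqF // scale1r total_rewardE.
  split=> [i|].
    rewrite !mxE mulr_ge0 ?invr_ge0 ?(ltW T0) //; apply: Rintegral_ge0 => t tT.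
    by case: (sx.2 t tT).
  under eq_bigr do rewrite !mxE.
  rewrite -mulr_sumr.
  rewrite (eq_bigr (fun i => 1 * \int[mu]_(s in `[0, T]) x s i 0)) => [|i _];
    last by rewrite mul1r.
  rewrite -Rintegral_lincomb // => [|i]; last exact: integrable_strategy.
  rewrite (@eq_Rintegral _ _ _ _ _ (cst 1)).
    by rewrite Rintegral_cst // mT mul1r mulVf // gt_eqF.
  move=> t /set_mem tT; under eq_bigr do rewrite mul1r.
  exact: (sx.2 t tT).2.
- have sx : strategy T (fun=> p) by split => // i; exact: measurable_cst.
  have cT : Defs.cumulative (fun=> p) T = T *: p.
    by apply/matrixP => i j; rewrite (ord1 j) !mxE Rintegral_cst // mT mulrC.
  by exists (fun=> p); rewrite ?total_rewardE ?cT.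
Qed.

End Reward.

(** * Existence of an optimal average and the two bounds on its reward *)

Section Bounds.
Context (R : realType) (n m : nat) (A : 'M[R]_(n.+1, m.+1)) (eta T : R).
Context (eta0 : 0 < eta) (T0 : 0 < T).

Lemma logsumexp_score_min : exists2 p : 'cV[R]_n.+1, simplex R n.+1 p &
  forall q, simplex R n.+1 q ->
    logsumexp (score A eta (T *: p)) <= logsumexp (score A eta (T *: q)).
Proof.
(* The sum of exponentials is minimized in place of its logarithm, which is monotone. *)
pose f (v : 'rV[R]_n.+1) : R := \sum_j expR (score A eta (T *: v^T) j).
have cf : continuous f.
  apply: (continuous_big (U := R)) => [|j _]; first exact: (@add_continuous R).
  have -> : (fun v : 'rV[R]_n.+1 => expR (score A eta (T *: v^T) j)) =
      (fun v => expR (\sum_i (- eta * A i j * T) * v 0 i)).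
    apply/funext => v; rewrite scoreE; congr expR; apply: eq_bigr => i _.
    by rewrite !mxE mulrA.
  move=> v; apply: continuous_comp; last exact: continuous_expR.
  apply: (continuous_big (U := R)) => [|i _]; first exact: (@add_continuous R).
  by move=> w; exact: cvgM (cvg_cst _) (@coord_continuous _ _ _ 0 i w).
have S0 : [set v : 'rV[R]_n.+1 | simplex R n.+1 v^T] !=set0.
  by exists (delta_mx 0 ord0); rewrite /= trmx_delta; exact: simplex_delta.
have [v /set_mem /= Sv vmin] :=
  EVT_min_rV S0 (@compact_simplex R n) (continuous_subspaceT cf).
exists v^T => // q Sq; rewrite /logsumexp ler_ln ?posrE ?sum_expR_gt0 //.
by have := vmin q^T; rewrite /f trmxK; apply; apply/mem_set; rewrite /= trmxK.
Qed.

Lemma mean_reward_le (p : 'cV[R]_n.+1) : simplex R n.+1 p ->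
  mean_reward A eta T p <= game_value A * T + ln m.+1%:R / eta.
Proof.
move=> Sp; have [[y [y0 y1] yE] _] := game_value_is_min A.
have pV : payoff A p y <= game_value A.
  by rewrite -yE; apply: (best_payoff_is_max A y).2; exists p.
(* Log-sum-exp dominates each coordinate of the score, hence their average under [y]. *)
have lse : - eta * T * payoff A p y <= logsumexp (score A eta (T *: p)).
  rewrite (payoff_score _ eta0) -[leRHS]mul1r -y1 mulr_suml.
  rewrite mulrA mulr_sumr; apply: ler_sum => j _.
  have -> : - eta * T * - eta^-1 * (y j 0 * score A eta p j) =
      y j 0 * score A eta (T *: p) j.
    by rewrite scoreZ; field; rewrite gt_eqF.
  by apply: ler_wpM2l => //; exact: le_logsumexp.
have := ler_wpM2l (mulr_ge0 (ltW eta0) (ltW T0)) pV.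
rewrite /mean_reward ler_pdivrMr // mulrDl divfK ?gt_eqF //.
by move: lse; lra.
Qed.

Lemma game_value_le_mean_reward (p : 'cV[R]_n.+1) : simplex R n.+1 p ->
  (forall q, simplex R n.+1 q ->
    logsumexp (score A eta (T *: p)) <= logsumexp (score A eta (T *: q))) ->
  game_value A * T <= mean_reward A eta T p.
Proof.
move=> Sp pmin; pose s := score A eta (T *: p).
pose y : 'cV[R]_m.+1 := \col_j softmax s j.
have Sy : simplex R m.+1 y.
  split=> [j|]; first by rewrite mxE softmax_ge0.
  by under eq_bigr do rewrite mxE; exact: softmax_sum1.
have payoffT q : payoff A q y * T =
    - eta^-1 * \sum_j softmax s j * score A eta (T *: q) j.
  rewrite (payoff_score _ eta0) -mulrA mulr_suml; congr (_ * _).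
  by apply: eq_bigr => j _; rewrite mxE scoreZ; ring.
have br q : simplex R n.+1 q -> payoff A q y <= payoff A p y.
  move=> [q0 q1]; rewrite -(ler_pM2r T0) !payoffT !mulNr lerN2.
  rewrite ler_pM2l ?invr_gt0 // -subr_ge0 -sumrB.
  under eq_bigr do rewrite -mulrBr.
  (* The direction is the score difference between [T *: q] and [T *: p]; since the score is linear,
     a step [e] reaches the score of a point on the segment from [p] to [q], which stays in the
     simplex. *)
  apply: logsumexp_first_order => e /andP[e0 e1].
  rewrite (_ : (fun j => _) = score A eta (T *: ((1 - e) *: p + e *: q))).
    apply: pmin; split=> [i|]; first by rewrite !mxE addr_ge0 // mulr_ge0 //
      ?subr_ge0 // ?(ltW e0) //; case: Sp.
    under eq_bigr do rewrite !mxE.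
    by rewrite big_split /= -!mulr_sumr q1 (proj2 Sp); ring.
  apply/funext => j; rewrite /s !scoreZ /score mulmxDr -!scalemxAr !mxE.
  by ring.
have Vp : game_value A <= payoff A p y.
  apply: le_trans (_ : best_payoff A y <= _).
    by apply: (game_value_is_min A).2; exists y.
  by have [q Sq <-] := (best_payoff_is_max A y).1; exact: br.
apply: le_trans (_ : payoff A p y * T <= _); first by rewrite ler_pM2r.
rewrite payoffT /mean_reward mulNr -mulrN mulrC ler_pM2r ?invr_gt0 //.
(* The tangent at [s] evaluated at the zero vector, where log-sum-exp is [ln m.+1%:R]. *)
rewrite -logsumexp0; apply: le_trans (logsumexp_tangent s (fun=> 0)).
by rewrite -sumrN; apply: ler_sum => j _; rewrite sub0r mulrN.
Qed.

Lemma rewards_bounds :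
  is_max (rewards eta T A) (optimal_reward eta T A) /\
  game_value A * T <= optimal_reward eta T A
    <= game_value A * T + ln m.+1%:R / eta.
Proof.
have [p Sp pmin] := logsumexp_score_min.
have pmax : is_max (rewards eta T A) (mean_reward A eta T p).
  rewrite (rewardsE _ eta0 T0); split=> [|_ [q Sq <-]]; first by exists p.
  by rewrite ler_pM2r ?invr_gt0 // lerD2l lerN2 pmin.
rewrite /optimal_reward (is_max_sup pmax); split=> //.
by rewrite game_value_le_mean_reward // mean_reward_le.
Qed.

End Bounds.

Theorem proposition6 (R : realType) (n m : nat) (A : 'M[R]_(n, m))
    (eta T : R) (hn : (0 < n)%N) (hm : (0 < m)%N)
    (heta : 0 < eta) (hT : 0 < T) :
  is_max (rewards eta T A) (optimal_reward eta T A) /\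
  game_value A * T <= optimal_reward eta T A
    <= game_value A * T + ln m%:R / eta.
Proof.
case: n hn A => [//|n] _; case: m hm => [//|m] _ A.
exact: rewards_bounds.
Qed.
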